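(* Let $(W_t)_{t\ge 0}$ be a standard Wiener process. Then almost surely $\|W_\cdot\|_{\widetilde A}<\infty$, where for $f\in C([0,1])$ $$\|f\|_{\widetilde A}:=\sup_{j\in\mathbb{N}_0}\ \sup_{0\le k\le j}\ \sup_{0<t<1}\ \frac{(\widetilde A_kf_j)^*(t)}{\sqrt{2^{k-j}\log(1/t)+1}}$$ and the path $W_\cdot$ is considered as the function $t\mapsto W_t$ on $[0,1]$.
   Context: Let $I=[0,1]$. For $j\in\mathbb{N}_0$ and $m\in\{0,\dots,2^j-1\}$ let $I_{j,m}=[m2^{-j},(m+1)2^{-j}]$ and let $\chi_{j,m}$ be its indicator function. For $f\in C(I)$ define $$\lambda_{j,m}(f)=-2^{j/2-1}\Big(f\big((m+1)2^{-j}\big)-2f\big((2m+1)2^{-j-1}\big)+f\big(m2^{-j}\big)\Big)$$ (the coefficients of $f$ in the expansion $f(x)=f(0)(1-x)+f(1)x+\sum_{j,m}2^{-j/2}\lambda_{j,m}v_{j,m}(x)$ in the Faber system of hat functions $v_{j,m}$ supported on $I_{j,m}$ with height $1$), and put $f_j=\sum_{m=0}^{2^j-1}\lambda_{j,m}(f)\chi_{j,m}$. For integrable $g$ on $I$ and $k\in\mathbb{N}_0$, $(A_kg)(x)=\sum_{l=0}^{2^k-1}2^k\int_{I_{k,l}}g(t)\,dt\cdot\chi_{k,l}(x)$ and $\widetilde A_kg=A_k(|g|)$. For measurable $h$ on $I$, $h^*(t)=\inf\{s\ge0:|\{x\in I:|h(x)|>s\}|\le t\}$ is the non-increasing rearrangement.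 *)

(* Defs.v *)
From HB Require Import structures.
From mathcomp Require Import all_boot all_order all_algebra.
From mathcomp Require Import all_classical all_reals all_analysis.
Set Implicit Arguments. Unset Strict Implicit. Unset Printing Implicit Defensive.
Import Order.TTheory GRing.Theory Num.Theory.
Import numFieldNormedType.Exports.
Local Open Scope classical_set_scope.
Local Open Scope ring_scope.

Definition dyI {R : realType} (j m : nat) : set R :=
  `[(m%:R / 2 ^+ j), (m.+1%:R / 2 ^+ j)].

Definition chi {R : realType} (j m : nat) (x : R) : R := \1_(@dyI R j m) x.

(* Faber coefficient lambda_{j,m}(f), with 2^{j/2-1} = sqrt(2^j)/2 *)
Definition lam {R : realType} (f : R -> R) (j m : nat) : R :=
  - (Num.sqrt (2 ^+ j) / 2) *
    (f (m.+1%:R / 2 ^+ j) - 2 * f ((2 * m).+1%:R / 2 ^+ j.+1) + f (m%:R / 2 ^+ j)).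

Definition fj {R : realType} (f : R -> R) (j : nat) (x : R) : R :=
  \sum_(m < 2 ^ j) lam f j m * @chi R j m x.

Definition Ak {R : realType} (k : nat) (g : R -> R) (x : R) : R :=
  \sum_(l < 2 ^ k)
     2 ^+ k * Rintegral (@lebesgue_measure R) (@dyI R k l) g * @chi R k l x.

Definition Atilde {R : realType} (k : nat) (g : R -> R) : R -> R :=
  Ak k (fun t => `|g t|).

Definition rearr {R : realType} (h : R -> R) (t : R) : \bar R :=
  ereal_inf [set s%:E | s in
    [set s : R | (0 <= s)%R /\
       (@lebesgue_measure R [set x : R | x \in `[0%R, 1%R] /\ (s < `|h x|)%R]
          <= t%:E)%E]].

Definition normAt {R : realType} (f : R -> R) : \bar R :=
  ereal_sup [set r : \bar R | exists (j k : nat) (t : R),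
     (k <= j)%N /\ 0 < t < 1 /\
     r = (rearr (Atilde k (fj f j)) t
          * ((Num.sqrt ((2 ^+ (j - k))^-1 * ln (t^-1) + 1))^-1)%:E)%E].

Definition standard_Wiener {d} {T : measurableType d} {R : realType}
    (P : probability T R) (W : R -> T -> R) : Prop :=
  [/\ (forall t, 0 <= t -> measurable_fun [set: T] (W t)),
      {ae P, forall w, W 0 w = 0},
      {ae P, forall w, {within `[0%R, +oo[, continuous (fun t => W t w)}} &
      (forall (n : nat) (s : nat -> R) (B : nat -> set R),
         0 <= s 0%N ->
         (forall i, (i < n)%N -> s i < s i.+1) ->
         (forall i, measurable (B i)) ->
         P (\bigcap_(i in [set i | (i < n)%N])
               [set w | B i (W (s i.+1) w - W (s i) w)])
         = (\prod_(i < n) normal_prob 0 (Num.sqrt (s i.+1 - s i)) (B i))%E)].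

(* Main.v *)
(* Write N = 2^(j-k). On I_{k,l} the function A~_k f_j is the mean of the N
   coefficients |lambda_{j,m}| of the block I_{j,m} in I_{k,l}. If it exceeds s,
   then the squares of these coefficients sum to at least N s^2, hence so do,
   up to a constant, the squares of the 2N rescaled increments of W over the
   block. Let Z_{k,n} (n = j - k) be the average over l < 2^k of the exponentials
   Q_l of a small multiple of these sums of squares. A bound Z_{k,n} <= M^N for
   all k and n yields, by Markov's inequality on {0, ..., 2^k - 1}, that the mean
   exceeds s on a set of measure at most M^N exp(- N s^2 / 2), which is at most
   t for s = C sqrt (log (1/t) / N + 1).
   Such a random M exists almost surely: the Q_l are independent with mean
   (4/3)^N and second moment 2^N, so Z_{k,n} has variance at most 2^-k 2^N, and
   sum_{k,n} 4^-N (Z_{k,n} - E Z_{k,n})^2 has finite expectation. *)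

Require Import Defs.
From HB Require Import structures.
From mathcomp Require Import all_boot all_order all_algebra.
From mathcomp Require Import all_classical all_reals all_analysis.
From mathcomp Require Import measurable_realfun ring lra zify.
Import Order.TTheory GRing.Theory Num.Theory.
Local Open Scope classical_set_scope.
Local Open Scope ring_scope.

(** * Change of variables and products of independent variables *)

Section integral_from_indicators.
Local Open Scope ereal_scope.
Import HBNNSimple.

(** The hypothesis on indicators says that [nu] is the image under [X] of the measure with density
    [H]; simple functions and monotone convergence extend it to [g]. It serves twice: with [H] the
    remaining factors of a product of independent variables, and with [H] a normal density and [X]
    the identity. *)
Lemma ge0_integral_from_indic (d1 d2 : measure_display)
    (S : measurableType d1) (U : measurableType d2) (R : realType)
    (mu : {measure set S -> \bar R}) (nu : {measure set U -> \bar R})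
    (X : S -> U) (H : S -> R) (g : U -> \bar R) :
    measurable_fun setT X -> measurable_fun setT H -> (forall x, (0 <= H x)%R) ->
    (forall A, measurable A -> \int[mu]_x (H x * \1_A (X x))%:E = nu A) ->
    measurable_fun setT g -> (forall y, 0 <= g y) ->
  \int[mu]_x ((H x)%:E * g (X x)) = \int[nu]_y g y.
Proof.
move=> mX mH H0 HA mg g0.
pose h := nnsfun_approx measurableT mg.
have cvgh y : EFin \o h^~ y @ \oo --> g y by exact: cvg_nnsfun_approx.
have ndh a b : (a <= b)%N -> forall y, (h a y <= h b y)%R.
  by move=> ab y; exact/lefP/nd_nnsfun_approx.
transitivity (limn (fun n => \int[mu]_x ((H x)%:E * (h n (X x))%:E))).
  rewrite -monotone_convergence//.
  - apply: eq_integral => x _; apply/esym/cvg_lim => //.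
    by apply: cvgeZl => //; exact: cvgh.
  - move=> n; apply: emeasurable_funM; first exact/measurable_EFinP.
    by apply/measurable_EFinP; apply: (measurableT_comp _ mX).
  - by move=> n x _; rewrite mule_ge0 ?lee_fin.
  - by move=> x _ a b ab; rewrite lee_wpmul2l ?lee_fin ?ndh.
transitivity (limn (fun n => \int[nu]_y (h n y)%:E)); last first.
  rewrite -monotone_convergence//.
  - by apply: eq_integral => x _; apply/cvg_lim => //; exact: cvgh.
  - by move=> n; exact/measurable_EFinP.
  - by move=> n x _; rewrite lee_fin.
  - by move=> x _ a b ab; rewrite lee_fin ndh.
congr (limn _); apply/funext => n.
have mA r : measurable (h n @^-1` [set r]) by [].
have mXA r : measurable_fun setT (fun x => \1_(h n @^-1` [set r]) (X x) : R).
  by apply: (measurableT_comp _ mX); exact: measurable_indic.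
transitivity (\sum_(r \in range (h n))
    \int[mu]_x (r%:E * (H x * \1_(h n @^-1` [set r]) (X x))%:E)).
  rewrite -ge0_integral_fsum//.
  - apply: eq_integral => x _; rewrite -EFinM {1}(fimfunE (h n)).
    rewrite mulr_fsumr// -fsumEFin//.
    by apply: eq_fsbigr => r _; rewrite -EFinM mulrCA.
  - move=> r; apply: emeasurable_funM => //.
    by apply/measurable_EFinP/measurable_funM.
  - move=> r x _; rewrite -EFinM mulrCA EFinM mule_ge0 ?lee_fin//.
    exact: nnfun_muleindic_ge0.
transitivity (\sum_(r \in range (h n)) \int[nu]_y (r * \1_(h n @^-1` [set r]) y)%:E).
  apply: eq_fsbigr => r /[!inE] -[y _ <-].
  rewrite ge0_integralZl//; last 3 first.
  - by apply/measurable_EFinP/measurable_funM.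
  - by move=> x _; rewrite lee_fin mulr_ge0.
  - by rewrite lee_fin.
  by rewrite HA// integralZl_indic_nnsfun// integral_indic// setIT.
rewrite -ge0_integral_fsum//.
- by apply: eq_integral => y _; rewrite [in RHS]fimfunE -fsumEFin.
- by move=> r; apply/measurable_EFinP/measurable_funM.
- by move=> r x _; rewrite nnfun_muleindic_ge0.
Qed.

End integral_from_indicators.

Section independence.
Local Open Scope ereal_scope.

(* Indicators are traded for the functions [g i] one index at a time. *)
Lemma integral_prod_indep (d d' : measure_display) (T : measurableType d)
    (U : measurableType d') (R : realType) (P : probability T R) (n : nat)
    (X : nat -> T -> U) (nu : nat -> probability U R) (g : nat -> U -> R)
    (kappa : nat -> R) :
    (forall i, (i < n)%N -> measurable_fun setT (X i)) ->
    (forall B : nat -> set U, (forall i, measurable (B i)) ->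
      P (\bigcap_(i in [set i | (i < n)%N]) [set w | B i (X i w)]) =
      \prod_(i < n) nu i (B i)) ->
    (forall i, measurable_fun setT (g i)) -> (forall i y, (0 <= g i y)%R) ->
    (forall i, \int[nu i]_y (g i y)%:E = (kappa i)%:E) ->
  \int[P]_w (\prod_(i < n) g i (X i w))%:E = (\prod_(i < n) kappa i)%:E.
Proof.
move=> mX indep mg g0 gkappa.
have kappa0 i : (0 <= kappa i)%R.
  by rewrite -lee_fin -gkappa; apply: integral_ge0 => y _; rewrite lee_fin.
have nuE i A : measurable A -> (fine (nu i A))%:E = nu i A.
  by move=> mA; rewrite fineK// fin_num_measure.
(* Indices below [r] already carry [g i], the others still an indicator; [m] holds the matching
   expectations. The case [r = 0] is the hypothesis on [P], the case [r = n] the conclusion. *)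
pose f r (B : nat -> set U) i (w : T) : R :=
  if (i < r)%N then g i (X i w) else \1_(B i) (X i w).
pose m r (B : nat -> set U) i : R :=
  if (i < r)%N then kappa i else fine (nu i (B i)).
have f0 r B i w : (0 <= f r B i w)%R by rewrite /f; case: ifP.
have m0 r B i : (0 <= m r B i)%R by rewrite /m; case: ifP => // _; exact: fine_ge0.
have mf r B i : (i < n)%N -> (forall i, measurable (B i)) ->
    measurable_fun setT (f r B i).
  move=> lin mB; rewrite /f; case: ltnP => _.
    exact: (measurableT_comp (mg i) (mX _ lin)).
  exact: (measurableT_comp (measurable_indic (mB i)) (mX _ lin)).
suff step r B : (r <= n)%N -> (forall i, measurable (B i)) ->
    \int[P]_w (\prod_(i < n) f r B i w)%:E = (\prod_(i < n) m r B i)%:E.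
  have := step n (fun=> set0) (leqnn n) (fun=> measurable0).
  rewrite (eq_bigr (fun i : 'I_n => kappa i)); last by move=> i _; rewrite /m ltn_ord.
  move=> <-; apply: eq_integral => w _; congr EFin.
  by apply: eq_bigr => i _; rewrite /f ltn_ord.
elim: r B => [|r IH] B rn mB.
  have -> : (\prod_(i < n) m 0%N B i)%:E = \prod_(i < n) nu i (B i).
    by rewrite -prodEFin; apply: eq_bigr => i _; exact: nuE.
  rewrite -indep//.
  rewrite -[X in P X]setIT -integral_indic//; last first.
    apply: bigcap_measurableType => // i /= lin.
    by rewrite -[X in measurable X]setTI; exact: mX.
  apply: eq_integral => w _; congr EFin; rewrite indicE.
  case: (boolP (w \in _)) => [/set_mem wB|wNB].
    by apply: big1 => i _; rewrite /f/= indicE mem_set//; apply: wB => /=.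
  have [i Bi] : exists i : 'I_n, ~ B i (X i w).
    apply: contrapT => /forallNP h; move/negP: wNB; apply; apply/mem_set.
    by move=> i /= lin; have /contrapT := h (Ordinal lin).
  by apply/eqP; rewrite (bigD1 i)//= {1}/f/= indicE memNset// mul0r.
pose j := Ordinal rn.
(* The factor of index [r] is split off. The image under [X r] of the measure with density [H] is
   [c] times [nu r]: on a set [A] this is the induction hypothesis with [B r] replaced by [A]. *)
pose H w := (\prod_(i < n | i != j) f r B i w)%R.
pose c := (\prod_(i < n | i != j) m r B i)%R.
have c0 : (0 <= c)%R by apply: prodr_ge0.
have ltrS (i : 'I_n) : i != j -> (i < r.+1)%N = (i < r)%N.
  by rewrite -val_eqE/= ltnS leq_eqVlt => /negbTE ->.
have HE w : (\prod_(i < n) f r.+1 B i w)%:E = (H w)%:E * (g r (X r w))%:E.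
  rewrite (bigD1 j)//= -EFinM [in RHS]mulrC {1}/f ltnSn; congr (_ * _)%:E.
  by apply: eq_bigr => i /ltrS; rewrite /f => ->.
under eq_integral do rewrite HE.
rewrite (@ge0_integral_from_indic _ _ _ _ _ _ (mscale (NngNum c0) (nu r)) _ _
  (fun y => (g r y)%:E))//.
- rewrite ge0_integral_mscale//=; last by move=> y _; rewrite lee_fin.
    rewrite gkappa -EFinM [in RHS](bigD1 j)//= {1}/m ltnSn mulrC.
    by congr (_ * _)%:E; apply: eq_bigr => i /ltrS; rewrite /m => ->.
  exact/measurable_EFinP.
- exact: mX.
- rewrite /H; under eq_fun do rewrite -big_filter.
  by apply: measurable_prod => i _; exact: mf.
- by move=> w; exact: prodr_ge0.
- move=> A mA.
  pose B' i := if i == r then A else B i.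
  have mB' i : measurable (B' i) by rewrite /B'; case: ifP.
  have B'E (i : 'I_n) : i != j -> B' i = B i.
    by rewrite /B' -val_eqE/= => /negbTE ->.
  transitivity (\int[P]_w (\prod_(i < n) f r B' i w)%:E).
    apply: eq_integral => w _; rewrite [in RHS](bigD1 j)//= mulrC {1}/f ltnn /B' eqxx.
    congr (_ * _)%:E; apply: eq_bigr => i ij.
    by rewrite /f -/(B' i) B'E.
  rewrite IH//; last exact: ltnW.
  rewrite (bigD1 j)//= {1}/m ltnn {1}/B' eqxx /mscale/= mulrC EFinM nuE//.
  congr (_%:E * _); apply: eq_bigr => i ij.
  by rewrite /m B'E.
- exact/measurable_EFinP.
- by move=> y; rewrite lee_fin.
Qed.

End independence.

(** * Exponential moments of the square of a normal variable *)

Section normal_moment.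
Local Open Scope ereal_scope.

Lemma integral_normal_prob (R : realType) (m s : R) (g : R -> \bar R) :
    measurable_fun setT g -> (forall y, 0 <= g y) ->
  \int[normal_prob m s]_y g y =
  \int[lebesgue_measure]_y ((normal_pdf m s y)%:E * g y).
Proof.
move=> mg g0; apply/esym.
apply: (@ge0_integral_from_indic _ _ _ _ _ lebesgue_measure (normal_prob m s) id)=> //.
- exact: measurable_normal_pdf.
- exact: normal_pdf_ge0.
- move=> A mA /=; rewrite /normal_prob [RHS]integral_mkcond.
  apply: eq_integral => x _; rewrite patchE indicE.
  by case: ifPn => xA; rewrite (mulr1,mulr0).
Qed.

(** With [q = sqrt (1 - c)], the integrand times the centred normal density of deviation [s] is
    [1 / q] times the one of deviation [s / q], whose integral is 1. *)
Lemma normal_exp_sqr_moment (R : realType) (s c : R) : (0 < s)%R -> (c < 1)%R ->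
  \int[normal_prob 0 s]_y (expR (c * (y ^+ 2 / (s ^+ 2 *+ 2))))%:E =
  ((Num.sqrt (1 - c))^-1)%:E.
Proof.
move=> s0 c1; have c0 : (0 < 1 - c)%R by rewrite subr_gt0.
have me : measurable_fun setT (fun y : R => (expR (c * (y ^+ 2 / (s ^+ 2 *+ 2))))%:E).
  apply/measurable_EFinP; apply: measurableT_comp => //.
  by apply: measurable_funM => //; apply: measurable_funM.
rewrite integral_normal_prob//.
pose q := Num.sqrt (1 - c).
have q0 : (0 < q)%R by rewrite sqrtr_gt0.
have q2 : (q ^+ 2 = 1 - c)%R by rewrite sqr_sqrtr// ltW.
have sq0 : (0 < s / q)%R by rewrite divr_gt0.
transitivity (\int[lebesgue_measure]_y ((q^-1)%:E * (normal_pdf 0 (s / q) y)%:E)).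
  apply: eq_integral => y _; rewrite -!EFinM !normal_pdfE ?gt_eqF//; congr EFin.
  rewrite /normal_peak /normal_fun !subr0.
  have -> : ((s / q) ^+ 2 * pi *+ 2 = (s ^+ 2 * pi *+ 2) / q ^+ 2)%R.
    by field; rewrite gt_eqF.
  rewrite sqrtrM; last by rewrite mulrn_wge0// mulr_ge0 ?sqr_ge0 ?pi_ge0.
  rewrite sqrtrV ?sqr_ge0// sqrtr_sqr gtr0_norm// invfM invrK.
  have qK a e : (q^-1 * (a * q * e) = a * e)%R by field; rewrite gt_eqF.
  rewrite qK -mulrA -expRD.
  congr (_ * expR _)%R.
  have -> : (- y ^+ 2 / ((s / q) ^+ 2 *+ 2) = - y ^+ 2 * q ^+ 2 / (s ^+ 2 *+ 2))%R.
    by field; rewrite !gt_eqF.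
  by rewrite q2; field; rewrite gt_eqF.
rewrite ge0_integralZl//.
- by rewrite integral_normal_pdf mule1.
- by apply/measurable_EFinP; exact: measurable_normal_pdf.
- by move=> y _; rewrite lee_fin normal_pdf_ge0.
- by rewrite lee_fin invr_ge0 ltW.
Qed.

End normal_moment.

(** * Counting and pairing indices in dyadic blocks *)

Lemma card_block (a b l : nat) : (l < a)%N ->
  #|[pred i : 'I_(a * b) | (i %/ b)%N == l]| = b.
Proof.
move=> la; rewrite -sum1_card big_mkcond/=.
rewrite -(big_mkord xpredT (fun i => if (i %/ b)%N == l then 1%N else 0%N)).
have [->|b0] := posnP b; first by rewrite muln0 big_geq.
have le1 : (l * b <= l.+1 * b)%N by rewrite leq_mul2r leqnSn orbT.
have le2 : (l.+1 * b <= a * b)%N by rewrite leq_mul2r la orbT.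
rewrite (@big_cat_nat _ _ _ (l * b))//=; last exact: leq_trans le2.
rewrite (@big_cat_nat _ _ _ (l.+1 * b) (l * b))//=.
rewrite big_nat big1 ?add0n; last first.
  by move=> i /andP[_ ilb]; rewrite -ltn_divLR// in ilb; rewrite ltn_eqF.
rewrite addnC big_nat big1 ?add0n; last first.
  by move=> i /andP[lib _]; rewrite -leq_divRL// in lib; rewrite gtn_eqF.
rewrite big_nat (eq_bigr (fun=> 1%N)); last first.
  move=> i /andP[lib ilb]; rewrite -leq_divRL// in lib; rewrite -ltn_divLR// in ilb.
  by have -> : (i %/ b)%N == l by rewrite eqn_leq lib -ltnS ilb.
by rewrite -big_nat sum_nat_const_nat muln1 mulSn addnK.
Qed.

(** The halves [2 m] and [2 m + 1] of an interval lie in the same block, because both quotients by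
    [2 b] equal [m %/ b]. This matches two increments with one Faber coefficient. *)
Lemma big_pairs (V : nmodType) (K b l : nat) (F : nat -> V) :
  \sum_(i < 2 * K | (i %/ (2 * b))%N == l) F i =
  \sum_(m < K | (m %/ b)%N == l) (F (2 * m)%N + F (2 * m).+1).
Proof.
rewrite [LHS]big_mkcond [RHS]big_mkcond/=.
elim: K => [|K IH]; first by rewrite muln0 !big_ord0.
rewrite [RHS]big_ord_recr/= -IH mulnS addSn !big_ord_recr/=.
have div2 : ((2 * K).+1 %/ (2 * b) = (2 * K) %/ (2 * b))%N.
  by rewrite !divnMA; congr (_ %/ _)%N; lia.
rewrite div2 divnMA mulKn// -addrA.
by case: ifP => // _; rewrite addr0.
Qed.

(** * Variance of an average, and almost sure bounds from summable expectations *)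

Section almost_sure_bounds.
Local Open Scope ereal_scope.

(* [(Z - mu)^2 + 2 mu Z = Z^2 + mu^2] keeps all the integrands nonnegative. *)
Lemma integral_mean_sqr_dev (d : measure_display) (T : measurableType d)
    (R : realType) (P : probability T R) (K : nat) (Q : 'I_K -> T -> R) (mu V : R) :
    (0 < K)%N -> (forall l, measurable_fun setT (Q l)) ->
    (forall l w, (0 <= Q l w)%R) ->
    (forall l, \int[P]_w (Q l w)%:E = mu%:E) ->
    (forall l l', \int[P]_w (Q l w * Q l' w)%:E <=
       (mu ^+ 2 + (l == l')%:R * V)%:E) ->
  \int[P]_w (((\sum_l Q l w) / K%:R - mu) ^+ 2)%:E <= (V / K%:R)%:E.
Proof.
move=> K0 mQ Q0 EQ EQQ.
have Kr0 : (0 < K%:R :> R)%R by rewrite ltr0n.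
have mu0 : (0 <= mu)%R.
  by rewrite -lee_fin -(EQ (Ordinal K0)); apply: integral_ge0 => y _; rewrite lee_fin.
pose Z w := ((\sum_l Q l w) / K%:R)%R.
have mS : measurable_fun setT (fun w => \sum_l Q l w)%R by exact: measurable_sum.
have mZ : measurable_fun setT Z by exact: measurable_funM.
have Z0 w : (0 <= Z w)%R by rewrite divr_ge0 ?sumr_ge0.
have EZ : \int[P]_w (Z w)%:E = mu%:E.
  under eq_integral do rewrite /Z mulrC EFinM.
  rewrite ge0_integralZl//; last 2 first.
  - exact/measurable_EFinP.
  - by move=> w _; rewrite lee_fin sumr_ge0.
  under eq_integral do rewrite -sumEFin.
  rewrite ge0_integral_sum//; last 2 first.
  - by move=> l; exact/measurable_EFinP.
  - by move=> l w _; rewrite lee_fin.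
  rewrite (eq_bigr (fun=> mu%:E))// sumEFin sumr_const card_ord -EFinM.
  by rewrite -[(mu *+ K)%R]mulr_natl mulKf// gt_eqF.
(* Each of the [K ^ 2] pairs contributes at most [mu ^ 2], and only the [K] diagonal ones add [V];
   dividing by [K ^ 2] leaves [V / K]. *)
have EZZ : \int[P]_w (Z w ^+ 2)%:E <= (mu ^+ 2 + V / K%:R)%:E.
  have ZZE w : (Z w ^+ 2)%:E =
      ((K%:R ^+ 2)^-1)%:E * \sum_l \sum_l' (Q l w * Q l' w)%:E.
    rewrite /Z exprMn exprVn mulrC EFinM; congr (_ * _).
    rewrite expr2 big_distrlr/= -sumEFin.
    by apply: eq_bigr => l _; rewrite -sumEFin.
  have mQQ l l' : measurable_fun setT (fun w => (Q l w * Q l' w)%:E).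
    by apply/measurable_EFinP; exact: measurable_funM.
  have QQ0 l l' w : 0 <= (Q l w * Q l' w)%:E by rewrite lee_fin mulr_ge0.
  under eq_integral do rewrite ZZE.
  rewrite ge0_integralZl//; last 2 first.
  - by apply: emeasurable_sum => l; exact: emeasurable_sum.
  - by move=> w _; apply: sume_ge0 => l _; exact: sume_ge0.
  rewrite ge0_integral_sum//; last 2 first.
  - by move=> l; exact: emeasurable_sum.
  - by move=> l w _; apply: sume_ge0.
  apply: (@le_trans _ _ (((K%:R ^+ 2)^-1)%:E *
      \sum_(l < K) \sum_(l' < K) (mu ^+ 2 + (l == l')%:R * V)%:E)).
    apply: lee_wpmul2l; first by rewrite lee_fin invr_ge0 sqr_ge0.
    by apply: lee_sum => l _; rewrite ge0_integral_sum//; exact: lee_sum.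
  under eq_bigr => l _.
    rewrite sumEFin big_split/= sumr_const card_ord (bigD1 l)//= eqxx mul1r.
    rewrite big1 ?addr0; last by move=> l' /negbTE; rewrite eq_sym => ->; rewrite mul0r.
    over.
  rewrite sumEFin sumr_const card_ord -EFinM lee_fin -mulr_natl -[(mu ^+ 2 *+ K)%R]mulr_natl.
  by rewrite le_eqVlt; apply/orP; left; apply/eqP; field; rewrite gt_eqF.
have dev0 w : (0 <= (Z w - mu) ^+ 2)%R by exact: sqr_ge0.
have mdev : measurable_fun setT (fun w => ((Z w - mu) ^+ 2)%:E).
  apply/measurable_EFinP; apply: measurable_funX.
  exact: measurable_funB.
have : \int[P]_w ((Z w - mu) ^+ 2)%:E + (2 * mu * mu)%:E <=
    (V / K%:R)%:E + (2 * mu * mu)%:E.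
  have -> : (2 * mu * mu)%:E = \int[P]_w ((2 * mu) * Z w)%:E.
    under eq_integral do rewrite EFinM.
    rewrite ge0_integralZl ?EZ//.
    - exact/measurable_EFinP.
    - by move=> w _; rewrite lee_fin.
    - by rewrite lee_fin mulr_ge0.
  rewrite -ge0_integralD//; last 3 first.
  - by move=> w _; rewrite lee_fin.
  - by move=> w _; rewrite lee_fin mulr_ge0// mulr_ge0.
  - by apply/measurable_EFinP; exact: measurable_funM.
  under eq_integral => w _.
    rewrite -EFinD (_ : (Z w - mu) ^+ 2 + 2 * mu * Z w = Z w ^+ 2 + mu ^+ 2)%R; last by ring.
    rewrite EFinD; over.
  rewrite ge0_integralD//; last 3 first.
  - by move=> w _; rewrite lee_fin sqr_ge0.
  - by apply/measurable_EFinP; exact: measurable_funX.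
  - by move=> w _; rewrite lee_fin sqr_ge0.
  under [X in _ <= _ + X]eq_integral do rewrite EFinM.
  rewrite ge0_integralZl ?EZ//; last 3 first.
  - exact/measurable_EFinP.
  - by move=> w _; rewrite lee_fin.
  - by rewrite lee_fin mulr_ge0.
  rewrite integral_cst//= probability_setT mule1.
  apply: (le_trans (leeD2r _ EZZ)).
  by rewrite -!EFinD lee_fin; lra.
by rewrite leeD2rE.
Qed.

(** The double series of the [Y k n] has expectation at most [c], by two geometric sums, so it is
    almost surely finite; its terms being nonnegative, its sum bounds each of them. *)
Lemma ae_bounded_of_summable (d : measure_display) (T : measurableType d)
    (R : realType) (P : probability T R) (Y : nat -> nat -> T -> R) (c : R) : (0 <= c)%R ->
    (forall k n, measurable_fun setT (Y k n)) ->
    (forall k n w, (0 <= Y k n w)%R) ->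
    (forall k n, \int[P]_w (Y k n w)%:E <=
       (c / (2 ^ k.+1)%:R / (2 ^ n.+1)%:R)%:E) ->
  {ae P, forall w, exists M : R, forall k n, (Y k n w <= M)%R}.
Proof.
move=> c0 mY Y0 EY.
pose S1 k w := \sum_(0 <= n <oo) (Y k n w)%:E.
pose S w := \sum_(0 <= k <oo) S1 k w.
have S10 k w : 0 <= S1 k w by apply: nneseries_ge0 => n _ _; rewrite lee_fin.
have S0 w : 0 <= S w by apply: nneseries_ge0 => k _ _.
have mYE k n : measurable_fun setT (fun w => (Y k n w)%:E) by exact/measurable_EFinP.
have mS1 k : measurable_fun setT (S1 k).
  by apply: ge0_emeasurable_sum => // n w _ _; rewrite lee_fin.
have mS : measurable_fun setT S by apply: ge0_emeasurable_sum.
have ES : \int[P]_w S w <= c%:E.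
  rewrite integral_nneseries//.
  apply: le_trans (epsilon_trick0 xpredT c0).
  apply: lee_nneseries => k *; first exact: integral_ge0.
  rewrite integral_nneseries//; last by move=> n w _; rewrite lee_fin.
  apply: le_trans (epsilon_trick0 xpredT _); last by rewrite divr_ge0.
  apply: lee_nneseries => n *; last exact: EY.
  by apply: integral_ge0 => w _; rewrite lee_fin.
have iS : P.-integrable setT S.
  apply/integrableP; split => //.
  under eq_integral do rewrite gee0_abs//.
  by rewrite (le_lt_trans ES)// ltry.
apply: filterS (integrable_ae measurableT iS) => w /(_ Logic.I) Sfin.
exists (fine (S w)) => k n; rewrite -lee_fin fineK//.
apply: (@le_trans _ _ (S1 k w)).
  rewrite /S1; apply: le_trans (nneseries_lim_ge n.+1 _).
    rewrite big_nat_recr//= leeDr//; apply: sume_ge0 => i _.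
    by rewrite lee_fin.
  by move=> i _ _; rewrite lee_fin.
rewrite /S; apply: le_trans (nneseries_lim_ge k.+1 _) => //.
by rewrite big_nat_recr//= leeDr//; apply: sume_ge0.
Qed.

End almost_sure_bounds.

(** * Exponential moments of the Wiener increments and the random constant [M] *)

Definition incr {R : realType} (f : R -> R) (J i : nat) : R :=
  f (i.+1%:R / 2 ^+ J) - f (i%:R / 2 ^+ J).

(* The variable Q_l of the header, with j = k + n: the increments have length
   2^-(j+1), and block l consists of the 2^(n+1) of them inside I_{k,l}. *)
Definition block_exp {R : realType} (f : R -> R) (k n l : nat) : R :=
  expR (2 ^+ (k + n) / 4 *
    \sum_(i < 2 ^ (k + n).+1 | (i %/ 2 ^ n.+1)%N == l) incr f (k + n).+1 i ^+ 2).

(** The average [Z_{k,n}] of the header. *)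
Definition block_mean {R : realType} (f : R -> R) (k n : nat) : R :=
  (\sum_(l < 2 ^ k) block_exp f k n l) / (2 ^ k)%:R.

(** An increment over a step [2 ^ -J] has variance [sigma ^ 2 = 2 ^ -J], so [2 ^ J / 2] times its
    square is [y ^ 2 / (2 sigma ^ 2)], and independence multiplies the normal moments. The free
    weights [e] cover both one block and a product of two. *)
Lemma wiener_exp_moment (d : measure_display) (T : measurableType d)
    (R : realType) (P : probability T R) (W : R -> T -> R) (J : nat)
    (e : nat -> R) :
    standard_Wiener P W -> (forall i, e i < 1) ->
  (\int[P]_w (expR (\sum_(i < 2 ^ J)
      e i * (2 ^+ J / 2 * incr (fun t => W t w) J i ^+ 2)))%:E =
   (\prod_(i < 2 ^ J) (Num.sqrt (1 - e i))^-1)%:E)%E.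
Proof.
move=> [mW _ _ incW] e1.
have pJ : 0 < 2 ^+ J :> R by rewrite exprn_gt0.
pose s : nat -> R := fun i => i%:R / 2 ^+ J.
have ds i : s i.+1 - s i = (2 ^+ J)^-1.
  by rewrite /s -mulrBl -natrB// subSnn mul1r.
pose sigma : R := Num.sqrt (2 ^+ J)^-1.
have sigma0 : 0 < sigma by rewrite sqrtr_gt0 invr_gt0.
have s0 i : 0 <= s i by rewrite divr_ge0// ltW.
pose g i (y : R) := expR (e i * (y ^+ 2 / (sigma ^+ 2 *+ 2))).
have mg i : measurable_fun setT (g i).
  apply: measurableT_comp => //; apply: measurable_funM => //.
  by apply: measurable_funM => //; exact: measurable_funX.
rewrite -(@integral_prod_indep _ _ _ (measurableTypeR R) _ P (2 ^ J)
  (fun i w => W (s i.+1) w - W (s i) w) (fun=> normal_prob 0 sigma) g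
  (fun i => (Num.sqrt (1 - e i))^-1))//.
- apply: eq_integral => w _; rewrite expR_sum; congr EFin.
  apply: eq_bigr => i _; rewrite /g /incr -/(s i) -/(s i.+1); congr (expR (_ * _)).
  rewrite sqr_sqrtr ?invr_ge0 ?ltW//.
  by field; rewrite gt_eqF.
- by move=> i _; apply: measurable_funB; exact: mW.
- move=> B mB.
  have ltS i : (i < 2 ^ J)%N -> s i < s i.+1.
    by move=> _; rewrite -subr_gt0 ds invr_gt0.
  apply: (etrans (incW (2 ^ J)%N s B (s0 0%N) ltS mB)).
  by apply: eq_bigr => i _; rewrite ds.
- by move=> i y; exact: expR_ge0.
- by move=> i; exact: normal_exp_sqr_moment.
Qed.

(** The constant [2 ^ (k + n) / 4] amounts to weight [1 / 4] on the block and 0 elsewhere. Even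
    doubled, as in a square, this weight stays below 1. *)
Lemma block_exp_weights (R : realType) (f : R -> R) (k n l : nat) :
  block_exp f k n l = expR (\sum_(i < 2 ^ (k + n).+1)
    ((i %/ 2 ^ n.+1)%N == l)%:R / 4 * (2 ^+ (k + n).+1 / 2 * incr f (k + n).+1 i ^+ 2)).
Proof.
rewrite /block_exp big_mkcond mulr_sumr; congr expR; apply: eq_bigr => i _.
by case: ifP => _ /=; rewrite [2 ^+ _.+1]exprS; field.
Qed.

(** The exponent is the size [2 ^ n.+1] of a block, written so that powers of a square root turn
    into powers with exponent [2 ^ n]. *)
Lemma prod_block (R : realType) (k n l : nat) (x : R) : (l < 2 ^ k)%N ->
  \prod_(i < 2 ^ (k + n).+1) (if (i %/ 2 ^ n.+1)%N == l then x else 1) =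
  x ^+ (2 * 2 ^ n).
Proof.
move=> lk; rewrite -big_mkcond/= prodr_const.
have -> : (2 ^ (k + n).+1 = 2 ^ k * 2 ^ n.+1)%N by rewrite -expnD addnS.
by rewrite card_block// expnS.
Qed.

(** Each increment in the block contributes [(1 - 1 / 4) ^ (-1 / 2) = sqrt (4 / 3)], every other one
    1. *)
Lemma integral_block_exp (d : measure_display) (T : measurableType d)
    (R : realType) (P : probability T R) (W : R -> T -> R) (k n l : nat) :
    standard_Wiener P W -> (l < 2 ^ k)%N ->
  (\int[P]_w (block_exp (fun t => W t w) k n l)%:E =
   ((4 / 3) ^+ (2 ^ n))%:E)%E.
Proof.
move=> hW lk; under eq_integral do rewrite block_exp_weights.
rewrite (wiener_exp_moment _ _ _ _ _ _ (fun i => ((i %/ 2 ^ n.+1)%N == l)%:R / 4))//; last first.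
  by move=> i; case: eqP => _ /=; lra.
congr EFin; rewrite -(@sqr_sqrtr _ (4 / 3)); last by lra.
rewrite -exprM -(prod_block _ _ _ _ _ lk); apply: eq_bigr => i _.
case: ifP => _ /=; last by rewrite mul0r subr0 sqrtr1 invr1.
rewrite -sqrtrV; last by lra.
by congr Num.sqrt; field.
Qed.

(** Multiplying the exponentials adds their weights. For [l = l'] the weight becomes [1 / 2], each
    factor [sqrt 2], and the product [2 ^ (2 ^ n)]. For [l <> l'] the blocks are disjoint and the
    product of the two means results. *)
Lemma integral_block_expM (d : measure_display) (T : measurableType d)
    (R : realType) (P : probability T R) (W : R -> T -> R) (k n l l' : nat) :
    standard_Wiener P W -> (l < 2 ^ k)%N -> (l' < 2 ^ k)%N ->
  (\int[P]_w (block_exp (fun t => W t w) k n l *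
              block_exp (fun t => W t w) k n l')%:E <=
   (((4 / 3) ^+ (2 ^ n)) ^+ 2 + (l == l')%:R * 2 ^+ (2 ^ n))%:E)%E.
Proof.
move=> hW lk lk'.
pose b l i : R := ((i %/ 2 ^ n.+1)%N == l)%:R / 4.
have b0 m i : (i %/ 2 ^ n.+1)%N != m -> b m i = 0.
  by rewrite /b => /negbTE ->; rewrite mul0r.
have b1 m i : (i %/ 2 ^ n.+1)%N = m -> b m i = 1 / 4.
  by rewrite /b => ->; rewrite eqxx.
have blt m i : b m i <= 1 / 4 by rewrite /b; case: eqP => _ /=; lra.
under eq_integral => w _.
  rewrite !block_exp_weights -expRD -big_split/=.
  under eq_bigr do rewrite -mulrDl -/(b l _) -/(b l' _).
  over.
rewrite (wiener_exp_moment _ _ _ _ _ _ (fun i => b l i + b l' i))//; last first.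
  by move=> i; have := blt l i; have := blt l' i; lra.
rewrite lee_fin; have [<-|ll'] := eqVneq l l'.
  rewrite mul1r ler_wpDl ?sqr_ge0// -(@sqr_sqrtr _ 2)// -exprM -(prod_block _ _ _ _ _ lk).
  apply: ler_prod => i _; rewrite invr_ge0 sqrtr_ge0/=.
  case: ifPn => [/eqP /b1 ->|/b0 ->]; last by rewrite addr0 subr0 sqrtr1 invr1.
  rewrite -sqrtrV; last by lra.
  by rewrite (_ : (1 - (1 / 4 + 1 / 4))^-1 = 2)//; field.
rewrite mul0r addr0 -(@sqr_sqrtr _ (4 / 3)); last by lra.
rewrite -!exprM (_ : (2 * (2 ^ n * 2) = 2 * 2 ^ n + 2 * 2 ^ n)%N); last by lia.
rewrite exprD -{1}(prod_block _ _ _ _ _ lk) -(prod_block _ _ _ _ _ lk') -big_split/=.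
apply: ler_prod => i _; rewrite invr_ge0 sqrtr_ge0/=.
have q : (Num.sqrt (1 - 1 / 4))^-1 = Num.sqrt (4 / 3) :> R.
  rewrite -sqrtrV; last by lra.
  by congr Num.sqrt; field.
case: ifPn => [/eqP il|/b0 ->].
  rewrite (b1 _ _ il) (b0 l') ?il// addr0 q.
  by rewrite (negbTE ll') mulr1.
rewrite add0r mul1r; case: ifPn => [/eqP /b1 ->|/b0 ->]; first by rewrite q.
by rewrite subr0 sqrtr1 invr1.
Qed.

Lemma measurable_block_exp (d : measure_display) (T : measurableType d)
    (R : realType) (W : R -> T -> R) (k n l : nat) :
    (forall t, 0 <= t -> measurable_fun setT (W t)) ->
  measurable_fun setT (fun w => block_exp (fun t => W t w) k n l).
Proof.
move=> mW; apply: measurableT_comp => //; apply: measurable_funM => //.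
under eq_fun do rewrite big_mkcond.
apply: measurable_sum => i; case: eqP => // _; apply: measurable_funX.
by apply: measurable_funB; apply: mW; rewrite divr_ge0.
Qed.

Lemma wiener_block_mean_bounded (d : measure_display) (T : measurableType d)
    (R : realType) (P : probability T R) (W : R -> T -> R) :
    standard_Wiener P W ->
  {ae P, forall w, exists2 M : R, 1 <= M &
    forall k n, block_mean (fun t => W t w) k n <= M ^+ (2 ^ n)}.
Proof.
move=> hW; have [mW _ _ _] := hW.
pose mu n : R := (4 / 3) ^+ (2 ^ n).
have mu0 n : 0 <= mu n by rewrite exprn_ge0//; lra.
pose Z k n w : R := block_mean (fun t => W t w) k n.
have mZ k n : measurable_fun setT (Z k n).
  apply: measurable_funM => //; apply: measurable_sum => l.
  exact: measurable_block_exp.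
(* The variance is at most [2 ^ (2 ^ n) / 2 ^ k], so dividing by [4 ^ (2 ^ n)] makes the
   expectations summable over [n] as well as over [k]. *)
pose Y k n w : R := (4 ^+ (2 ^ n))^-1 * (Z k n w - mu n) ^+ 2.
have Y0 k n w : 0 <= Y k n w by rewrite mulr_ge0 ?sqr_ge0 ?invr_ge0 ?exprn_ge0.
have mdev k n : measurable_fun setT (fun w => (Z k n w - mu n) ^+ 2).
  by apply: measurable_funX; exact: measurable_funB.
have EY k n : (\int[P]_w (Y k n w)%:E <= (2 / (2 ^ k.+1)%:R / (2 ^ n.+1)%:R)%:E)%E.
  under eq_integral do rewrite EFinM.
  rewrite ge0_integralZl//; last 2 first.
  - exact/measurable_EFinP.
  - by move=> w _; rewrite lee_fin sqr_ge0.
  have dev : (\int[P]_w ((Z k n w - mu n) ^+ 2)%:E <= (2 ^+ (2 ^ n) / (2 ^ k)%:R)%:E)%E.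
    apply: (@integral_mean_sqr_dev _ _ _ P (2 ^ k)
      (fun l w => block_exp (fun t => W t w) k n l)) => [|l|l w|l|l l'].
    - by rewrite expn_gt0.
    - exact: measurable_block_exp.
    - exact: expR_ge0.
    - exact: integral_block_exp.
    - exact: integral_block_expM.
  apply: le_trans (lee_wpmul2l _ dev) _; first by rewrite lee_fin invr_ge0 exprn_ge0.
  rewrite -EFinM lee_fin (_ : 4 = 2 * 2 :> R); last by lra.
  rewrite exprMn [(2 ^ k.+1)%N]expnS natrM.
  have a0 : 0 < 2 ^+ (2 ^ n) :> R by rewrite exprn_gt0.
  have b0 : 0 < (2 ^ k)%:R :> R by rewrite ltr0n expn_gt0.
  have c0 : 0 < (2 ^ n.+1)%:R :> R by rewrite ltr0n expn_gt0.
  (* What remains in [n] is [2 ^ -(2 ^ n)], which [n + 1 <= 2 ^ n] places below the geometric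
     weight. *)
  have ca : (2 ^ n.+1)%:R <= 2 ^+ (2 ^ n) :> R.
    by rewrite -natrX ler_nat leq_exp2l// ltn_expl.
  rewrite [leRHS](_ : _ = ((2 ^ k)%:R)^-1 * ((2 ^ n.+1)%:R)^-1); last first.
    by field; rewrite !gt_eqF.
  rewrite [leLHS](_ : _ = ((2 ^ k)%:R)^-1 * (2 ^+ (2 ^ n))^-1); last first.
    by field; rewrite !gt_eqF.
  by rewrite ler_pM2l ?invr_gt0// lef_pV2.
have mY k n : measurable_fun setT (Y k n) by exact: measurable_funM.
apply: filterS (@ae_bounded_of_summable _ _ _ P Y 2 (ler0n _ _) mY Y0 EY) => w [M YM].
have M0 : 0 <= M := le_trans (Y0 0%N 0%N w) (YM 0%N 0%N).
(* With [N = 2 ^ n], the bound on [Y] gives [Z - mu <= (1 + M) 2 ^ N], since [M <= (1 + M) ^ 2]. As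
   [mu <= 2 ^ N], it follows that [Z <= (2 + M) 2 ^ N], and [2 + M] is at most its [N]-th power. *)
exists (2 * (2 + M)); first by lra.
move=> k n; rewrite -/(Z k n w).
set p : R := 2 ^+ (2 ^ n).
have p0 : 0 < p by rewrite exprn_gt0.
have p4 : 4 ^+ (2 ^ n) = p * p by rewrite -exprMn; congr (_ ^+ _); lra.
have dev : (Z k n w - mu n) ^+ 2 <= p * p * M.
  by move: (YM k n); rewrite /Y p4 ler_pdivrMl// mulr_gt0.
have Zp : Z k n w - mu n <= (1 + M) * p.
  rewrite leNgt; apply/negP => lt.
  have q0 : 0 <= (1 + M) * p by rewrite mulr_ge0 ?ltW//; lra.
  have : ((1 + M) * p) ^+ 2 < (Z k n w - mu n) ^+ 2 by rewrite ltr_pXn2r// nnegrE; lra.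
  have : p * p * M <= ((1 + M) * p) ^+ 2.
    rewrite exprMn mulrC -expr2 ler_pM2r ?exprn_gt0//; nra.
  by lra.
have mup : mu n <= p by rewrite lerXn2r// ?nnegrE; lra.
have : Z k n w <= p * (2 + M) by nra.
move=> /le_trans; apply.
rewrite exprMn ler_pM2l// ler_eXnr ?expn_gt0//; lra.
Qed.


(** * Closed dyadic intervals and level sets of step functions *)

Lemma measurable_dyI (R : realType) (j m : nat) : measurable (@dyI R j m).
Proof. exact: measurable_itv. Qed.

Lemma lebesgue_measure_dyI (R : realType) (j m : nat) :
  lebesgue_measure (@dyI R j m) = ((2 ^+ j)^-1)%:E.
Proof.
have p0 : 0 < 2 ^+ j :> R by rewrite exprn_gt0.
rewrite /dyI lebesgue_measure_itv/= lte_fin ltr_pM2r ?invr_gt0// ltr_nat ltnSn.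
by rewrite -EFinD -mulrBl -natrB// subSnn mul1r.
Qed.

Lemma measurable_chi (R : realType) (j m : nat) :
  measurable_fun setT (@chi R j m).
Proof. exact: measurable_indic (measurable_dyI _ _ _). Qed.

(** An interval of the finer level outside block [l] lies entirely on one side of [I_{j,l}], and
    closed intervals can then meet only at an endpoint. The case [n = 0] handles neighbours on one
    level. *)
Lemma dyI_common_endpoint (R : realType) (j n l m : nat) (x : R) :
    x \in @dyI R (j + n) m -> x \in @dyI R j l -> (m %/ 2 ^ n)%N != l ->
  x = l%:R / 2 ^+ j \/ x = l.+1%:R / 2 ^+ j.
Proof.
rewrite !inE /dyI/= !in_itv/= => /andP[mx xm] /andP[lx xl].
have p0 (i : nat) : 0 < 2 ^+ i :> R by rewrite exprn_gt0.
have scale a : a%:R / 2 ^+ j = (a * 2 ^ n)%:R / 2 ^+ (j + n) :> R.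
  by rewrite exprD natrM natrX; field; rewrite !gt_eqF.
rewrite neq_ltn => /orP[|].
  rewrite ltn_divLR ?expn_gt0// => ml; left; apply/le_anti; rewrite lx andbT.
  by rewrite (le_trans xm)// scale ler_pM2r ?invr_gt0// ler_nat.
rewrite leq_divRL ?expn_gt0// => ml; right; apply/le_anti; rewrite xl/=.
by rewrite (le_trans _ mx)// scale ler_pM2r ?invr_gt0// ler_nat.
Qed.

Lemma lebesgue_measure_dyI_cap (R : realType) (k n l m : nat) :
  (lebesgue_measure (@dyI R (k + n) m `&` @dyI R k l) <=
   (if (m %/ 2 ^ n)%N == l then (2 ^+ (k + n))^-1 else 0)%:E)%E.
Proof.
have mI := measurable_dyI R.
case: ifPn => ml.
  rewrite -(lebesgue_measure_dyI R (k + n) m); apply: le_measure.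
  - by apply/mem_set; exact: (measurableI _ _ (mI _ _) (mI _ _)).
  - by apply/mem_set; exact: mI.
  - exact: subIsetl.
rewrite (countable_lebesgue_measure0 _)//.
apply: (@sub_countable _ _ _ [set l%:R / 2 ^+ k; l.+1%:R / 2 ^+ k]).
  apply: subset_card_le => x [xm xl].
  by apply: (@dyI_common_endpoint _ k n l m) => //; exact/mem_set.
exact: finite_set_countable.
Qed.

(** Closed neighbours overlap, so at a grid point two coefficients may add up. The grid [D] is null,
    and off it the sum reduces to a single [b l]. *)
Lemma lebesgue_measure_step_gt (R : realType) (k : nat) (b : nat -> R) (s : R) :
    0 <= s ->
  (lebesgue_measure [set x : R | x \in `[0%R, 1%R] /\
      (s < `|\sum_(l < 2 ^ k) b l * @chi R k l x|)%R]
   <= \sum_(l < 2 ^ k) (if s < `|b l| then (2 ^+ k)^-1 else 0)%R%:E)%E.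
Proof.
move=> s0; set E := [set x | _].
pose h (x : R) := \sum_(l < 2 ^ k) b l * @chi R k l x.
pose F l : set R := if s < `|b l| then @dyI R k l else set0.
pose D : set R := range (fun l : nat => l%:R / 2 ^+ k).
have mF l : measurable (F l) by rewrite /F; case: ltP => // _; exact: measurable_dyI.
have cD : countable D by exact: card_image_le.
have mD : measurable D by exact: countable_measurable.
have mh : measurable_fun setT h.
  apply: measurable_sum => l; apply: measurable_funM => //.
  exact: measurable_chi.
have mE : measurable E.
  rewrite (_ : E = `[0, 1]%classic `&` (Num.norm \o h) @^-1` `]s, +oo[%classic).
    apply: measurableI => //; rewrite -[X in measurable X]setTI.
    by apply: measurableT_comp.
  by apply/seteqP; split => x /=; rewrite !in_itv/= andbT.
have mUF : measurable (\big[setU/set0]_(l < 2 ^ k) F l).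
  by apply: bigsetU_measurable.
apply: (@le_trans _ _ (lebesgue_measure (D `|` \big[setU/set0]_(l < 2 ^ k) F l))).
  apply: le_measure; rewrite ?inE//; first exact: measurableU.
  move=> x [_ sx]; have [xD|xD] := pselect (D x); [by left|right].
  (* A point in no interval would give the value 0, which does not exceed [s]. *)
  have [l xl] : exists l : 'I_(2 ^ k), x \in @dyI R k l.
    apply: contrapT => /forallNP nx.
    have h0 : h x = 0.
      by rewrite /h big1// => l _; rewrite /chi indicE; have /negP/negbTE -> := nx l; rewrite mulr0.
    by move: sx; rewrite -/(h x) h0 normr0 ltNge s0.
  have hb : h x = b l.
    rewrite /h (bigD1 l)//= big1 ?addr0; last first.
      move=> l' l'l; rewrite /chi indicE; have [xl'|] := boolP (_ \in _); last by rewrite mulr0.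
      have xl0 : x \in @dyI R (k + 0) l' by rewrite addn0.
      exfalso; apply: xD.
      have /(dyI_common_endpoint _ _ _ _ _ _ xl0 xl)[->|->] : (l' %/ 2 ^ 0)%N != l.
        by rewrite divn1.
      - by exists l.
      - by exists l.+1.
    by rewrite /chi indicE xl mulr1.
  apply: (bigsetU_sup (ltn_ord l)).
  by rewrite /F -hb sx; exact/set_mem.
apply: le_trans; first exact: measureU2.
rewrite [X in (X + _)%E](countable_lebesgue_measure0 cD) add0e.
apply: le_trans; first by apply: Boole_inequality => l _; exact: mF.
apply: lee_sum => l _; rewrite /F.
by case: ltP => _; rewrite ?measure0// -(lebesgue_measure_dyI R k l).
Qed.

(** * Pathwise estimates: from increments to the rearrangement *)

(** The second difference is the difference of the increments over the two halves, and
    [(a - b) ^ 2 <= 2 (a ^ 2 + b ^ 2)]. *)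
Lemma lam_sqr (R : realType) (f : R -> R) (j m : nat) :
  lam f j m ^+ 2 <=
  2 ^+ j / 2 * (incr f j.+1 (2 * m)%N ^+ 2 + incr f j.+1 (2 * m).+1 ^+ 2).
Proof.
have p0 : 0 < 2 ^+ j :> R by rewrite exprn_gt0.
have half a : (2 * a)%:R / 2 ^+ j.+1 = a%:R / 2 ^+ j :> R.
  by rewrite natrM exprS; field; rewrite gt_eqF.
rewrite /lam /incr half (_ : (2 * m).+2 = 2 * m.+1)%N; last by lia.
rewrite half exprMn sqrrN exprMn sqr_sqrtr; last exact: ltW.
set x := f (m%:R / _); set y := f (_ / 2 ^+ j.+1); set z := f _.
have key : (z - 2 * y + x) ^+ 2 / 4 <= ((y - x) ^+ 2 + (z - y) ^+ 2) / 2.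
  by have := sqr_ge0 (z - x); nra.
rewrite [leLHS](_ : _ = 2 ^+ j * ((z - 2 * y + x) ^+ 2 / 4)); last by field.
by rewrite -mulrA (mulrC 2^-1) ler_pM2l.
Qed.

(** After the triangle inequality, each [I_{j,m}] in the block contributes its length [2 ^ -j],
    while the others meet [I_{k,l}] in a null set. *)
Lemma Rintegral_fj_le (R : realType) (f : R -> R) (k n l : nat) :
  \int[lebesgue_measure]_(t in @dyI R k l) `|fj f (k + n) t| <=
  (\sum_(m < 2 ^ (k + n) | (m %/ 2 ^ n)%N == l) `|lam f (k + n) m|) / 2 ^+ (k + n).
Proof.
set j := (k + n)%N; set B := (_ / _).
have mI := measurable_dyI R.
have mchi m := measurable_chi R j m.
(* [Rintegral] takes the [fine] part of an extended integral: the bound excludes [+oo], and [-oo]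
   would become 0, below the nonnegative [B]. *)
suff : (\int[lebesgue_measure]_(t in @dyI R k l) (`|fj f j t|)%:E <= B%:E)%E.
  rewrite /Rintegral; case: (\int[_]_(_ in _) _)%E => [r||]/=.
  - by rewrite lee_fin.
  - by [].
  - by move=> _; rewrite divr_ge0 ?exprn_ge0 ?sumr_ge0.
apply: (@le_trans _ _ (\int[lebesgue_measure]_(t in @dyI R k l)
    (\sum_(m < 2 ^ j) (`|lam f j m|)%:E * (\1_(@dyI R j m) t)%:E)%E)%E).
  apply: ge0_le_integral => //.
  - exact: mI.
  - apply/measurable_funTS/measurable_EFinP; apply: measurableT_comp => //.
    apply: measurable_sum => m; apply: measurable_funM => //.
    exact: mchi.
  - apply: emeasurable_sum => m; apply/measurable_funTS/measurable_EFinP.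
    by apply: measurable_funM => //; exact: mchi.
  - move=> t _; under eq_bigr do rewrite -EFinM.
    rewrite sumEFin lee_fin (le_trans (ler_norm_sum _ _ _))//.
    by apply: ler_sum => m _; rewrite normrM /chi ler_wpM2l// ger0_norm.
rewrite ge0_integral_sum//; last 2 first.
- exact: mI.
- move=> m; apply/measurable_funTS/measurable_EFinP.
  by apply: measurable_funM => //; exact: mchi.
rewrite /B mulr_suml [in leRHS]big_mkcond -sumEFin; apply: lee_sum => m _.
rewrite ge0_integralZl//; last 2 first.
- exact: mI.
- by apply/measurable_funTS/measurable_EFinP; exact: mchi.
rewrite integral_indic; [|exact: mI..].
apply: (le_trans (lee_wpmul2l _ (lebesgue_measure_dyI_cap R k n l m))).
  by rewrite lee_fin.
by rewrite -EFinM lee_fin; case: ifP => _//; rewrite mulr0.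
Qed.

(* [2 s |lam| <= lam^2 + s^2], summed over a block. *)
Lemma block_exp_large (R : realType) (f : R -> R) (k n l : nat) (s : R) :
    (l < 2 ^ k)%N -> 0 <= s ->
    2 ^+ n * s <= \sum_(m < 2 ^ (k + n) | (m %/ 2 ^ n)%N == l) `|lam f (k + n) m| ->
  expR (2 ^+ n * s ^+ 2 / 2) <= block_exp f k n l.
Proof.
move=> lk s0 ns; rewrite /block_exp ler_expR.
set j := (k + n)%N in ns *.
have sum_sqr : 2 ^+ n * s ^+ 2 <= \sum_(m < 2 ^ j | (m %/ 2 ^ n)%N == l) lam f j m ^+ 2.
  have cs : \sum_(m < 2 ^ j | (m %/ 2 ^ n)%N == l) (2 * s * `|lam f j m|) <=
      \sum_(m < 2 ^ j | (m %/ 2 ^ n)%N == l) (lam f j m ^+ 2 + s ^+ 2).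
    apply: ler_sum => m _; rewrite -(real_normK (num_real (lam f j m))).
    by have := sqr_ge0 (`|lam f j m| - s); nra.
  move: cs; rewrite -mulr_sumr big_split/= sumr_const.
  have -> : #|[pred m : 'I_(2 ^ j) | (m %/ 2 ^ n)%N == l]| = (2 ^ n)%N.
    by rewrite /j expnD card_block.
  rewrite -[s ^+ 2 *+ _]mulr_natl natrX.
  have := ler_wpM2l s0 ns; nra.
(* Half of this right-hand side is the exponent in [block_exp], whence the division by 2 in the
   statement. *)
have pairs : \sum_(m < 2 ^ j | (m %/ 2 ^ n)%N == l) lam f j m ^+ 2 <=
    2 ^+ j / 2 * \sum_(i < 2 ^ j.+1 | (i %/ 2 ^ n.+1)%N == l) incr f j.+1 i ^+ 2.
  rewrite !expnS (big_pairs _ _ _ _ (fun i => incr f j.+1 i ^+ 2)) mulr_sumr; apply: ler_sum => m _; exact: lam_sqr.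
lra.
Qed.

(** The number [s] is shown to be admissible in the infimum defining the rearrangement, by Markov's
    inequality over the blocks. *)
Lemma rearr_Atilde_le (R : realType) (f : R -> R) (M : R) (k n : nat) (t : R) :
    1 <= M -> block_mean f k n <= M ^+ (2 ^ n) -> 0 < t ->  t < 1 ->
  (rearr (Atilde k (fj f (k + n))) t <=
   (Num.sqrt (2 * (1 + ln M)) * Num.sqrt ((2 ^+ n)^-1 * ln (t^-1) + 1))%:E)%E.
Proof.
move=> M1 hM t0 t1; set s := _ * _.
have M0 : 0 < M by exact: lt_le_trans M1.
have lnM0 : 0 <= ln M by exact: ln_ge0.
have lnt0 : 0 <= ln t^-1 by rewrite ln_ge0// invf_ge1// ltW.
have p0 : 0 < 2 ^+ n :> R by rewrite exprn_gt0.
have s0 : 0 <= s by rewrite mulr_ge0.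
(* The constant in [s] is chosen for this identity: with [N = 2 ^ n], the right side is at least
   [ln (1 / t) + N ln M], which absorbs [M ^ N] and leaves [t]. *)
have s2 : 2 ^+ n * s ^+ 2 / 2 = (1 + ln M) * (ln t^-1 + 2 ^+ n).
  rewrite exprMn !sqr_sqrtr.
  - by field; rewrite gt_eqF.
  - by rewrite addr_ge0// mulr_ge0// invr_ge0 ltW.
  - by rewrite mulr_ge0// addr_ge0.
apply: ereal_inf_lbound; exists s => //; split => //.
pose b l := 2 ^+ k * \int[lebesgue_measure]_(u in @dyI R k l) `|fj f (k + n) u|.
have b0 l : 0 <= b l by rewrite mulr_ge0 ?exprn_ge0 ?Rintegral_ge0.
apply: (le_trans (lebesgue_measure_step_gt R k b s s0)).
rewrite sumEFin lee_fin.
have pk : 0 < 2 ^+ k :> R by rewrite exprn_gt0.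
(* Markov's inequality: a block whose mean exceeds [s] has [block_exp] at least the exponential of
   [2 ^ n s ^ 2 / 2]. *)
apply: (@le_trans _ _ (block_mean f k n * expR (- (2 ^+ n * s ^+ 2 / 2)))).
  rewrite /block_mean mulrAC mulr_suml mulr_suml; apply: ler_sum => l _.
  case: ifPn => sb; last by rewrite !mulr_ge0 ?expR_ge0 ?invr_ge0.
  rewrite natrX ler_peMl ?invr_ge0 ?exprn_ge0// expRN ler_pdivlMr ?expR_gt0// mul1r.
  apply: block_exp_large => //.
  rewrite ger0_norm// in sb.
  have := Rintegral_fj_le R f k n l.
  rewrite -(ler_pM2l pk) -/(b l) => /(lt_le_trans sb)/ltW.
  by rewrite exprD -(ler_pM2l p0) => /le_trans; apply; rewrite le_eqVlt; apply/orP;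
    left; apply/eqP; field; rewrite !gt_eqF.
apply: (@le_trans _ _ (M ^+ (2 ^ n) * expR (- (2 ^+ n * s ^+ 2 / 2)))).
  by rewrite ler_wpM2r ?expR_ge0.
have tE : t = expR (- ln t^-1) by rewrite lnV ?posrE// opprK lnK ?posrE.
rewrite [leRHS]tE -[M in leLHS]lnK ?posrE// -expRM_natl -expRD ler_expR s2 natrX.
by nra.
Qed.

(** With [n = j - k] the denominator of the norm is the second factor of the bound on the
    rearrangement; the remaining factor [C] depends on [M] alone. *)
Lemma normAt_lty (R : realType) (f : R -> R) (M : R) :
    1 <= M -> (forall k n, block_mean f k n <= M ^+ (2 ^ n)) ->
  (normAt f < +oo)%E.
Proof.
move=> M1 hM; pose C := Num.sqrt (2 * (1 + ln M)).
apply: (@le_lt_trans _ _ C%:E); last exact: ltry.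
apply: ge_ereal_sup => _ [j [k [t [kj [/andP[t0 t1] ->]]]]].
set q := Num.sqrt _.
have q0 : 0 < q.
  rewrite sqrtr_gt0 ltr_wpDl// mulr_ge0 ?invr_ge0 ?exprn_ge0//.
  by rewrite ln_ge0// invf_ge1// ltW.
apply: (@le_trans _ _ ((C * q)%:E * q^-1%:E)%E).
  apply: lee_wpmul2r; first by rewrite lee_fin invr_ge0 ltW.
  have := @rearr_Atilde_le R f M k (j - k) t M1 (hM _ _) t0 t1.
  by rewrite subnKC.
by rewrite -EFinM mulfK// gt_eqF.
Qed.

Theorem theorem2p10 (d : measure_display) (T : measurableType d) (R : realType)
  (P : probability T R) (W : R -> T -> R) :
  standard_Wiener P W ->
  {ae P, forall w, (normAt (fun t => W t w) < +oo)%E}.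
Proof.
move=> hW; apply: filterS (wiener_block_mean_bounded _ _ _ _ _ hW) => w [M M1 hM].
exact: normAt_lty M1 hM.
Qed.
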